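(* Let $A\in\mathbb{R}^{m\times n}$, $g(z)=(A^\top z^{\mathsf y},-Az^{\mathsf x})$, $w_0\in\mathcal{Z}$ and $\tau>0$. In the $\ell_2$-$\ell_1$ setup, consider the gradient estimator with $\mathcal{X}$ block $$\tilde g_{w_0}^{\mathsf x}(w)=A^\top w_0^{\mathsf y}+A_{i:}\frac{[w^{\mathsf y}]_i-[w_0^{\mathsf y}]_i}{p_i(w)},\qquad i\sim p(w),\quad p_i(w)=\frac{|[w^{\mathsf y}]_i-[w_0^{\mathsf y}]_i|}{\|w^{\mathsf y}-w_0^{\mathsf y}\|_1},$$ and $\mathcal{Y}$ block given, for each $i\in[m]$, by $$[\tilde g_{w_0}^{\mathsf y}(w)]_i=-[Aw_0^{\mathsf x}]_i-\mathsf T_\tau\left(A_{ij(i)}\frac{[w^{\mathsf x}]_{j(i)}-[w_0^{\mathsf x}]_{j(i)}}{q^{(i)}_{j(i)}}\right),$$ where, independently for every $i\in[m]$, $j(i)\in[n]$ is drawn from the distribution $q^{(i)}_j=A_{ij}^2/\|A_{i:}\|_2^2$, and $\mathsf T_\tau(a)=\min\{\tau,\max\{-\tau,a\}\}$. This estimator is $(w_0,L,\tau)$-CBB for $g$ with $L=\|A\|_{2\to\infty}=\max_{i\in[m]}\|A_{i:}\|_2$.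
   Context: $\ell_2$-$\ell_1$ setup: $\mathcal{X}=\{x\in\mathbb{R}^n:\|x\|_2\le1\}$, $\mathcal{Y}=\{y\in\mathbb{R}^m:y\ge0,\|y\|_1=1\}$, $\mathcal{Z}=\mathcal{X}\times\mathcal{Y}$; $z^{\mathsf x},z^{\mathsf y}$ are the first $n$ and last $m$ coordinates of $z$; norm $\|z\|^2=\|z^{\mathsf x}\|_2^2+\|z^{\mathsf y}\|_1^2$, dual norm $\|\gamma\|_*^2=\|\gamma^{\mathsf x}\|_2^2+\|\gamma^{\mathsf y}\|_\infty^2$. $A_{i:}$ is the $i$th row of $A$ as a vector. Increments are $0$ when the sampling distribution is undefined ($w^{\mathsf y}=w_0^{\mathsf y}$, or $A_{i:}=0$). A stochastic estimator $\tilde g_{w_0}:\mathcal{Z}\to\mathcal{Z}^*$ is $(w_0,L,\tau)$-centered-bounded-biased (CBB) for $g$ if for all $w\in\mathcal{Z}$: (1) $\mathbb{E}\tilde g^{\mathsf x}_{w_0}(w)=g^{\mathsf x}(w)$ and $\|\mathbb{E}\tilde g^{\mathsf y}_{w_0}(w)-g^{\mathsf y}(w)\|_\infty\le\frac{L^2}{\tau}\|w-w_0\|^2$; (2) $\|\tilde g^{\mathsf y}_{w_0}(w)-g^{\mathsf y}(w_0)\|_\infty\le\tau$; (3) $\mathbb{E}\|\tilde g^{\mathsf x}_{w_0}(w)-g^{\mathsf x}(w_0)\|_2^2+\max_{i\in[m]}\mathbb{E}[\tilde g^{\mathsf y}_{w_0}(w)-g^{\mathsf y}(w_0)]_i^2\le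 L^2\|w-w_0\|^2$. *)

(* Defs.v *)
From HB Require Import structures.
From mathcomp Require Import all_boot all_order all_algebra.
From mathcomp Require Import all_classical all_reals all_analysis.

Set Implicit Arguments.
Unset Strict Implicit.
Unset Printing Implicit Defensive.

Import Order.TTheory GRing.Theory Num.Theory.
Import numFieldNormedType.Exports.

Local Open Scope classical_set_scope.
Local Open Scope ring_scope.

(* The ambient space R^n * R^m of Z and of its dual; z.1 is the x-block and
   z.2 the y-block. *)
Definition zvec (R : realType) (n m : nat) : Type := ('cV[R]_n * 'cV[R]_m)%type.

Section Norms.
Context {R : realType}.

Definition l2norm (k : nat) (v : 'cV[R]_k) : R :=
  Num.sqrt (\sum_(i < k) v i 0 ^+ 2).

Definition l1norm (k : nat) (v : 'cV[R]_k) : R := \sum_(i < k) `|v i 0|.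

(* mx_norm is the maximum of the absolute values of the entries. *)
Definition linfnorm (k : nat) (v : 'cV[R]_k) : R := mx_norm v.

Definition znorm (n m : nat) (z : zvec R n m) : R :=
  Num.sqrt (l2norm z.1 ^+ 2 + l1norm z.2 ^+ 2).

Definition Arow (m n : nat) (A : 'M[R]_(m, n)) (i : 'I_m) : 'cV[R]_n :=
  (row i A)^T.

Definition norm_2_inf (m n : nat) (A : 'M[R]_(m, n)) : R :=
  \big[Num.max/0]_(i < m) l2norm (Arow A i).

End Norms.

Section Setup.
Context {R : realType} {n m : nat}.

Definition Xset : set 'cV[R]_n := [set x : 'cV[R]_n | l2norm x <= 1].

Definition Yset : set 'cV[R]_m :=
  [set y : 'cV[R]_m | (forall i : 'I_m, 0 <= y i 0) /\ l1norm y = 1].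

Definition Zset : set (zvec R n m) := [set z : zvec R n m | Xset z.1 /\ Yset z.2].

Definition bilinear_grad (A : 'M[R]_(m, n)) (z : zvec R n m) : zvec R n m :=
  (A^T *m z.2, - (A *m z.1)).

End Setup.

Section Probability.
Context {R : realType} {d : measure_display} {T : measurableType d}.
Variable P : probability T R.

Definition integrable_vec (k : nat) (X : T -> 'cV[R]_k) : Prop :=
  forall i : 'I_k, P.-integrable setT (fun t => (X t i 0%R)%:E).

(* Meaningful for integrable_vec X, where each coordinate is finite. *)
Definition expectation_vec (k : nat) (X : T -> 'cV[R]_k) : 'cV[R]_k :=
  \col_i fine ('E_P[fun t => X t i 0%R])%E.

(* The finitely-valued variable X is distributed according to the weights p. *)
Definition has_law (I : finType) (X : T -> I) (p : I -> R) : Prop :=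
  forall a : I,
    measurable (X @^-1` [set a]) /\ P (X @^-1` [set a]) = (p a)%:E.

(* Mutual independence of the discrete variables X i, i in S.  For variables
   with finitely many values the product rule on points suffices. *)
Definition mutually_independent (K I : finType) (S : {set K})
    (X : K -> T -> I) : Prop :=
  forall (U : {set K}) (a : K -> I), U \subset S ->
    P (\bigcap_(i in [set` U]) (X i @^-1` [set a i])) =
    (\prod_(i in U) P (X i @^-1` [set a i]))%E.

(* A stochastic estimator is a random vector gt w for every w in Z.  The
   uniform bound is required for every outcome, not only almost surely.  The
   last clause bounds second moments, E([v]_i ^ 2) for the y-block; its maximum
   is taken in the extended reals, over nonnegative quantities. *)
Definition CBB (n m : nat) (g : zvec R n m -> zvec R n m) (w0 : zvec R n m)
    (L tau : R) (gt : zvec R n m -> T -> zvec R n m) : Prop :=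
  forall w : zvec R n m, Zset w ->
  let dist := znorm (w - w0 : zvec R n m) in
  [/\ integrable_vec (fun t => (gt w t).1) /\
      integrable_vec (fun t => (gt w t).2),
      expectation_vec (fun t => (gt w t).1) = (g w).1 /\
      linfnorm (expectation_vec (fun t => (gt w t).2) - (g w).2)
        <= L ^+ 2 / tau * dist ^+ 2,
      forall t : T, linfnorm ((gt w t).2 - (g w0).2) <= tau
    & ('E_P[fun t => (l2norm ((gt w t).1 - (g w0).1) ^+ 2)%R]
       + \big[maxe/0]_(i < m)
           'E_P[fun t => ((((gt w t).2 - (g w0).2) i 0) ^+ 2)%R]
       <= (L ^+ 2 * dist ^+ 2)%R%:E)%E].

End Probability.

Section Estimator.
Context {R : realType} {n m : nat}.
Variables (A : 'M[R]_(m, n)) (w0 : zvec R n m).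

Definition p_law (w : zvec R n m) (i : 'I_m) : R :=
  `|w.2 i 0 - w0.2 i 0| / l1norm (w.2 - w0.2).

Definition q_law (i : 'I_m) (j : 'I_n) : R :=
  A i j ^+ 2 / l2norm (Arow A i) ^+ 2.

Definition clip (tau a : R) : R := Num.min tau (Num.max (- tau) a).

(* The increments are 0 when the sampling distribution is undefined. *)
Definition est_x (w : zvec R n m) (i : 'I_m) : 'cV[R]_n :=
  A^T *m w0.2 +
  (if w.2 == w0.2 then 0
   else ((w.2 i 0 - w0.2 i 0) / p_law w i) *: Arow A i).

Definition est_y (tau : R) (w : zvec R n m) (j : 'I_m -> 'I_n) : 'cV[R]_m :=
  \col_i (- (A *m w0.1) i 0 -
    (if Arow A i == 0 then 0
     else clip tau (A i (j i) * ((w.1 (j i) 0 - w0.1 (j i) 0)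
                                 / q_law i (j i))))).

(* The indices I w and J w i drawn at w have the prescribed distributions
   (whenever these are defined), and the J w i are mutually independent. *)
Definition sampling (d : measure_display) (T : measurableType d)
    (P : probability T R) (I : zvec R n m -> T -> 'I_m)
    (J : zvec R n m -> 'I_m -> T -> 'I_n) : Prop :=
  forall w : zvec R n m, Zset w ->
  [/\ w.2 != w0.2 -> has_law P (I w) (p_law w),
      forall i : 'I_m, Arow A i != 0 -> has_law P (J w i) (q_law i)
    & mutually_independent P [set i : 'I_m | Arow A i != 0]%SET (J w)].

Definition estimator (T : Type) (tau : R) (I : zvec R n m -> T -> 'I_m)
    (J : zvec R n m -> 'I_m -> T -> 'I_n) (w : zvec R n m) (t : T) :
    zvec R n m :=
  (est_x w (I w t), est_y tau w (fun i => J w i t)).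

End Estimator.

(* Main.v *)
(* Both blocks are a constant plus a function of one discrete random index, so
   every expectation is a finite sum against the sampling law.  Importance
   sampling makes the x-block unbiased, with second moment
   \sum_i |Ai|^2 |Di| |D|_1 <= L^2 |D|_1^2 where D = w.2 - w0.2; before clipping,
   the i-th y-increment a has mean [A (w.1 - w0.1)]_i and second moment at most
   |Ai|^2 |w.1 - w0.1|^2.  Clipping only decreases the second moment, and the
   bias it creates is controlled by |clip tau a - a| <= a^2 / tau. *)

Require Import Defs.
From HB Require Import structures.
From mathcomp Require Import all_boot all_order all_algebra.
From mathcomp Require Import all_classical all_reals all_analysis.
From mathcomp Require Import ring lra.

Set Implicit Arguments.
Unset Strict Implicit.
Unset Printing Implicit Defensive.

Local Open Scope ring_scope.

Import Order.TTheory GRing.Theory Num.Theory.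
Import numFieldNormedType.Exports.

(** * Norms and their squares *)

Section Norms.
Context {R : realType}.

Lemma sqr_l2norm (k : nat) (v : 'cV[R]_k) :
  l2norm v ^+ 2 = \sum_(i < k) v i 0 ^+ 2.
Proof. by rewrite sqr_sqrtr// sumr_ge0// => i _; rewrite sqr_ge0. Qed.

Lemma sqr_l2normZ (k : nat) (c : R) (v : 'cV[R]_k) :
  l2norm (c *: v) ^+ 2 = c ^+ 2 * l2norm v ^+ 2.
Proof.
by rewrite !sqr_l2norm mulr_sumr; apply: eq_bigr => i _; rewrite mxE exprMn.
Qed.

Lemma sqr_l2norm_eq0 (k : nat) (v : 'cV[R]_k) : (l2norm v ^+ 2 == 0) = (v == 0).
Proof.
apply/eqP/eqP => [|->]; last first.
  by rewrite sqr_l2norm big1// => i _; rewrite mxE expr0n.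
rewrite sqr_l2norm => /eqP; rewrite psumr_eq0 => [/allP v0|i _]; last exact: sqr_ge0.
apply/colP => i; rewrite mxE; apply/eqP.
by have := v0 i (mem_index_enum i); rewrite sqrf_eq0.
Qed.

Lemma l1norm_eq0 (k : nat) (v : 'cV[R]_k) : l1norm v = 0 -> v = 0.
Proof.
move/eqP; rewrite psumr_eq0// => /allP v0; apply/colP => i; rewrite mxE.
by apply/eqP; have := v0 i (mem_index_enum i); rewrite normr_eq0.
Qed.

Lemma sqr_znorm (n m : nat) (z : zvec R n m) :
  znorm z ^+ 2 = l2norm z.1 ^+ 2 + l1norm z.2 ^+ 2.
Proof. by rewrite sqr_sqrtr// addr_ge0// sqr_ge0. Qed.

(** The maximum defining the norm starts from 0, hence the condition [0 <= c]. *)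
Lemma linfnorm_le (k : nat) (v : 'cV[R]_k) (c : R) :
  0 <= c -> (forall i, `|v i 0| <= c) -> linfnorm v <= c.
Proof.
move=> c0 vc; rewrite /linfnorm mx_normrE; apply: bigmax_le => // -[i j] _ /=.
by rewrite ord1.
Qed.

Lemma sqr_l2norm_Arow_le (m n : nat) (A : 'M[R]_(m, n)) (i : 'I_m) :
  l2norm (Arow A i) ^+ 2 <= norm_2_inf A ^+ 2.
Proof.
have le_iL : l2norm (Arow A i) <= norm_2_inf A by exact: le_bigmax.
by rewrite lerXn2r// nnegrE ?(le_trans _ le_iL)// sqrtr_ge0.
Qed.

End Norms.

(** * Clipping at level [tau] *)

Section Clip.
Context {R : realType}.
Implicit Types tau a : R.

Lemma normr_clip tau a : 0 < tau -> `|clip tau a| <= tau.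
Proof.
move=> tau0; rewrite /clip ler_norml.
by case: (leP (- tau) a) => ?; case: (leP tau _) => ?; lra.
Qed.

Lemma sqr_clip tau a : 0 < tau -> clip tau a ^+ 2 <= a ^+ 2.
Proof.
move=> tau0; rewrite /clip.
by case: (leP (- tau) a) => ?; case: (leP tau _) => ?; nra.
Qed.

(** The error is 0 if |a| <= tau; otherwise it is |a| - tau <= |a| <= a^2 / tau. *)
Lemma clip_bias tau a : 0 < tau -> `|clip tau a - a| <= a ^+ 2 / tau.
Proof.
move=> tau0; rewrite ler_pdivlMr//.
rewrite -[X in _ * X](ger0_norm (ltW tau0)) -normrM ler_norml.
rewrite /clip; apply/andP.
by case: (leP (- tau) a) => ?; case: (leP tau _) => ?; split; nra.
Qed.

End Clip.

(** * Expectations under a finite law *)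

Section FiniteLaw.
Context {R : realType} {d : measure_display} {T : measurableType d}.
Variables (P : probability T R) (I : finType) (X : T -> I) (p : I -> R).
Hypothesis Xp : has_law P X p.

(** A combination of indicators of level sets reduces integrals of [f (X t)] to the probabilities
    given by [has_law]. *)
Let sum_indicE (f : I -> R) t :
  (f (X t))%:E = (\sum_a ((f a)%:E * (\1_(X @^-1` [set a]) t)%:E))%E.
Proof.
rewrite (bigD1 (X t))//= big1 => [|a aX]; last first.
  rewrite indicE memNset ?mule0//= => Xta; by rewrite Xta eqxx in aX.
by rewrite indicE mem_set// mule1 adde0.
Qed.

Lemma has_law_integrable (f : I -> R) :
  P.-integrable setT (fun t => (f (X t))%:E).
Proof.
under eq_fun do rewrite sum_indicE.
apply: integrable_sum => // a _; apply: integrableZl => //.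
by apply: integrable_indic; exact: (Xp a).1.
Qed.

Lemma has_law_expectation (f : I -> R) :
  'E_P[fun t => f (X t)]%E = (\sum_a f a * p a)%:E.
Proof.
have iI a : P.-integrable setT (fun t => (\1_(X @^-1` [set a]) t)%:E).
  by apply: integrable_indic; exact: (Xp a).1.
rewrite unlock; under eq_integral do rewrite sum_indicE.
rewrite integral_sum//; last by move=> a; apply: integrableZl => //; exact: iI.
rewrite -sumEFin; apply: eq_bigr => a _; rewrite integralZl//.
have [mXa PXa] := Xp a.
by rewrite integral_indic// setIT EFinM; congr (_ * _)%E.
Qed.

Lemma has_law_ge0 a : 0 <= p a.
Proof. by rewrite -lee_fin -(Xp a).2 measure_ge0. Qed.

(** Normalization is not part of [has_law]; it comes from the expectation of the constant 1. *)
Lemma has_law_sum1 : \sum_a p a = 1.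
Proof.
have := has_law_expectation (fun=> 1); rewrite expectation_cst => -[->].
by apply: eq_bigr => a _; rewrite mul1r.
Qed.

End FiniteLaw.

(** * Moments of the increments under [p_law] and [q_law] *)

Section SamplingLaws.
Context {R : realType} {n m : nat}.
Variables (A : 'M[R]_(m, n)) (w0 w : zvec R n m).

Let dx : 'cV[R]_n := w.1 - w0.1.
Let dy : 'cV[R]_m := w.2 - w0.2.

(** If the displacement at [i] is 0, both sides vanish; otherwise the weight is nonzero and
    cancels. *)
Lemma p_law_mean i : w.2 != w0.2 ->
  (w.2 i 0 - w0.2 i 0) / p_law w0 w i * p_law w0 w i = w.2 i 0 - w0.2 i 0.
Proof.
move=> ww0; have [->|d0] := eqVneq (w.2 i 0 - w0.2 i 0) 0; first by rewrite !mul0r.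
rewrite divfK// /p_law mulf_neq0 ?normr_eq0// invr_neq0//.
by apply: contraNneq ww0 => /l1norm_eq0/eqP; rewrite subr_eq0.
Qed.

Lemma p_law_second_moment i : w.2 != w0.2 ->
  ((w.2 i 0 - w0.2 i 0) / p_law w0 w i) ^+ 2 * p_law w0 w i =
  `|dy i 0| * l1norm dy.
Proof.
move=> ww0; rewrite expr2 -mulrA p_law_mean// /p_law /dy !mxE -/dy.
have [->|d0] := eqVneq (w.2 i 0 - w0.2 i 0) 0; first by rewrite normr0 !mul0r.
have N0 : l1norm dy != 0.
  by apply: contraNneq ww0 => /l1norm_eq0/eqP; rewrite subr_eq0.
(* The square is written as |D_i|^2, so that the |D_i| in the weight cancels. *)
rewrite mulrAC -expr2 -real_normK ?num_real//.
by field; rewrite N0 normr_eq0 d0.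
Qed.

Lemma q_law_mean i j : Arow A i != 0 ->
  A i j * ((w.1 j 0 - w0.1 j 0) / q_law A i j) * q_law A i j = A i j * dx j 0.
Proof.
move=> Ai0; have [->|Aij0] := eqVneq (A i j) 0; first by rewrite !mul0r.
rewrite -mulrA divfK /dx ?mxE// mulf_neq0 ?sqrf_eq0// invr_neq0//.
by rewrite sqr_l2norm_eq0.
Qed.

(** Equality holds if [A i j != 0]; if [A i j = 0] the left side is 0 while the right side may be
    positive. *)
Lemma q_law_second_moment i j : Arow A i != 0 ->
  (A i j * ((w.1 j 0 - w0.1 j 0) / q_law A i j)) ^+ 2 * q_law A i j <=
  l2norm (Arow A i) ^+ 2 * dx j 0 ^+ 2.
Proof.
move=> Ai0; have [Aij0|Aij0] := eqVneq (A i j) 0.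
  by rewrite Aij0 mul0r expr0n/= mul0r mulr_ge0 ?sqr_ge0.
rewrite expr2 -mulrA q_law_mean// /q_law /dx !mxE.
have N0 : l2norm (Arow A i) != 0 by rewrite -sqrf_eq0 sqr_l2norm_eq0.
by rewrite le_eqVlt; apply/orP; left; apply/eqP; field; rewrite N0.
Qed.

Lemma sum_q_law_second_moment i : Arow A i != 0 ->
  \sum_j (A i j * ((w.1 j 0 - w0.1 j 0) / q_law A i j)) ^+ 2 * q_law A i j <=
  norm_2_inf A ^+ 2 * l2norm dx ^+ 2.
Proof.
move=> Ai0; apply: le_trans (_ : l2norm (Arow A i) ^+ 2 * l2norm dx ^+ 2 <= _).
  rewrite [l2norm dx ^+ 2]sqr_l2norm mulr_sumr.
  by apply: ler_sum => j _; exact: q_law_second_moment.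
by rewrite ler_wpM2r ?sqr_ge0// sqr_l2norm_Arow_le.
Qed.

End SamplingLaws.

(** * The two blocks of the estimator *)

Section Blocks.
Context {R : realType} {n m : nat}.
Variables (A : 'M[R]_(m, n)) (w0 w : zvec R n m) (tau : R).
Context {d : measure_display} {T : measurableType d} (P : probability T R).

Section XBlock.
Variable I : T -> 'I_m.
Hypothesis Ip : w.2 != w0.2 -> has_law P I (p_law w0 w).

(** No law is available when [w.2 = w0.2], but the block is then constant; the same split recurs
    below. *)
Lemma est_x_integrable : integrable_vec P (fun t => est_x A w0 w (I t)).
Proof.
move=> k; rewrite /est_x; have [ww0|ww0] := eqVneq w.2 w0.2.
  exact: finite_measure_integrable_cst.
have := has_law_integrable (Ip ww0)
  (fun i => (A^T *m w0.2 + (w.2 i 0 - w0.2 i 0) / p_law w0 w i *: Arow A i) k 0).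
exact.
Qed.

Lemma est_x_unbiased :
  expectation_vec P (fun t => est_x A w0 w (I t)) = (bilinear_grad A w).1.
Proof.
apply/colP => k; rewrite mxE /est_x /=; have [ww0|ww0] := eqVneq w.2 w0.2.
  by rewrite addr0 expectation_cst/= ww0.
rewrite (has_law_expectation (Ip ww0) (fun i => (A^T *m w0.2 +
  (w.2 i 0 - w0.2 i 0) / p_law w0 w i *: Arow A i) k 0))/=.
under eq_bigr => i _ do
  rewrite mxE [X in _ + X]mxE mulrDl mulrAC (p_law_mean i ww0).
rewrite big_split/= -mulr_sumr (has_law_sum1 (Ip ww0)) mulr1.
rewrite !mxE -big_split/=; apply: eq_bigr => i _; rewrite !mxE; ring.
Qed.

Lemma est_x_second_moment :
  ('E_P[fun t => (l2norm (est_x A w0 w (I t) - (bilinear_grad A w0).1) ^+ 2)%R]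
   <= (norm_2_inf A ^+ 2 * l1norm (w.2 - w0.2) ^+ 2)%:E)%E.
Proof.
rewrite /est_x /=; have [ww0|ww0] := eqVneq w.2 w0.2.
  rewrite addr0 subrr expectation_cst lee_fin.
  have /eqP -> : l2norm (0 : 'cV[R]_n) ^+ 2 == 0 by rewrite sqr_l2norm_eq0.
  by rewrite mulr_ge0 ?sqr_ge0.
under eq_fun do rewrite addrC addKr sqr_l2normZ.
rewrite (has_law_expectation (Ip ww0) (fun i =>
  ((w.2 i 0 - w0.2 i 0) / p_law w0 w i) ^+ 2 * l2norm (Arow A i) ^+ 2)) lee_fin.
under eq_bigr => i _ do rewrite mulrAC p_law_second_moment//.
(* Only one factor [l1norm (w.2 - w0.2)] is expanded into its sum, which allows a termwise
   comparison. *)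
rewrite expr2 mulrA [X in _ <= X * _]mulr_sumr mulr_suml.
apply: ler_sum => i _; rewrite mulrC mulrA ler_wpM2r ?sumr_ge0//.
by rewrite ler_wpM2r// sqr_l2norm_Arow_le.
Qed.

End XBlock.

Section YBlock.
Variable J : 'I_m -> T -> 'I_n.
Hypothesis tau0 : 0 < tau.
Hypothesis Jq : forall i, Arow A i != 0 -> has_law P (J i) (q_law A i).

Let est t := est_y A w0 tau w (fun i => J i t).

(** The increment before clipping, as a function of the sampled index. *)
Let incr i j : R := A i j * ((w.1 j 0 - w0.1 j 0) / q_law A i j).

Lemma est_y_integrable : integrable_vec P est.
Proof.
move=> i; under eq_fun do rewrite mxE.
have [Ai0|Ai0] := eqVneq (Arow A i) 0; first exact: finite_measure_integrable_cst.
exact: (has_law_integrable (Jq Ai0)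
  (fun j => - (A *m w0.1) i 0 - clip tau (incr i j))).
Qed.

Lemma est_y_sub i t :
  (est t - (bilinear_grad A w0).2) i 0 =
  - (if Arow A i == 0 then 0 else clip tau (incr i (J i t))).
Proof. by rewrite !mxE /= addrC addKr. Qed.

Lemma est_y_bounded t : linfnorm (est t - (bilinear_grad A w0).2) <= tau.
Proof.
apply: linfnorm_le => [|i]; first exact: ltW.
rewrite est_y_sub normrN; case: ifPn => _; last exact: normr_clip.
by rewrite normr0 ltW.
Qed.

Lemma est_y_second_moment i :
  ('E_P[fun t => (((est t - (bilinear_grad A w0).2) i 0) ^+ 2)%R]
   <= (norm_2_inf A ^+ 2 * l2norm (w.1 - w0.1) ^+ 2)%:E)%E.
Proof.
under eq_fun do rewrite est_y_sub sqrrN.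
have [Ai0|Ai0] := eqVneq (Arow A i) 0.
  by rewrite expectation_cst lee_fin expr0n/= mulr_ge0 ?sqr_ge0.
rewrite (has_law_expectation (Jq Ai0) (fun j => clip tau (incr i j) ^+ 2)) lee_fin.
apply: le_trans (sum_q_law_second_moment w0 w Ai0); apply: ler_sum => j _.
by rewrite ler_wpM2r ?(has_law_ge0 (Jq Ai0))// sqr_clip.
Qed.

Lemma est_y_bias :
  linfnorm (expectation_vec P est - (bilinear_grad A w).2)
  <= norm_2_inf A ^+ 2 / tau * l2norm (w.1 - w0.1) ^+ 2.
Proof.
have B0 : 0 <= norm_2_inf A ^+ 2 / tau * l2norm (w.1 - w0.1) ^+ 2.
  by rewrite mulr_ge0 ?sqr_ge0// divr_ge0 ?sqr_ge0// ltW.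
apply: linfnorm_le => // i; rewrite !mxE/=; under eq_fun do rewrite mxE.
have [Ai0|Ai0] := eqVneq (Arow A i) 0.
  (* On a zero row both products with [A] vanish, so the zero increment is exact. *)
  have A0 j : A i j = 0 by have /colP/(_ j) := Ai0; rewrite !mxE.
  rewrite expectation_cst/= subr0 !mxE !big1 ?subrr ?normr0//.
  - by move=> j _; rewrite A0 mul0r.
  - by move=> j _; rewrite A0 mul0r.
rewrite (has_law_expectation (Jq Ai0)
  (fun j => - (A *m w0.1) i 0 - clip tau (incr i j)))/=.
under eq_bigr do rewrite mulrBl.
rewrite sumrB -mulr_sumr (has_law_sum1 (Jq Ai0)) mulr1 mxE opprK.
(* The unclipped increment has the exact mean, so the bias is minus the mean clipping error. *)
have -> : - (\sum_j A i j * w0.1 j 0) - \sum_j clip tau (incr i j) * q_law A i j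
    + \sum_j A i j * w.1 j 0 =
    - \sum_j (clip tau (incr i j) - incr i j) * q_law A i j.
  under [in RHS]eq_bigr => j _ do rewrite mulrBl (q_law_mean w0 w j Ai0).
  rewrite -!sumrN -!big_split/=.
  by apply: eq_bigr => j _; rewrite !mxE; ring.
rewrite normrN mulrAC ler_pdivlMr//.
(* [clip_bias], averaged over [q_law], bounds this error by the second moment of [incr] divided by
   [tau]. *)
apply: le_trans (sum_q_law_second_moment w0 w Ai0).
rewrite -ler_pdivlMr// mulr_suml; apply: le_trans (ler_norm_sum _ _ _) _.
apply: ler_sum => j _; have q0 := has_law_ge0 (Jq Ai0) j.
by rewrite normrM (ger0_norm q0) mulrAC ler_wpM2r// clip_bias.
Qed.

End YBlock.

End Blocks.

(** * Verification of the CBB conditions *)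

Theorem lemma9 (R : realType) (m n : nat) (A : 'M[R]_(m, n))
    (w0 : zvec R n m) (tau : R)
    (d : measure_display) (T : measurableType d) (P : probability T R)
    (I : zvec R n m -> T -> 'I_m) (J : zvec R n m -> 'I_m -> T -> 'I_n) :
  Zset w0 -> 0 < tau ->
  sampling A w0 P I J ->
  CBB P (bilinear_grad A) w0 (norm_2_inf A) tau (estimator A w0 tau I J).
Proof.
move=> _ tau0 samp w Zw dist; have [Ip Jq _] := samp w Zw.
have dist2 : dist ^+ 2 = l2norm (w.1 - w0.1) ^+ 2 + l1norm (w.2 - w0.2) ^+ 2.
  exact: sqr_znorm.
split.
- by split; [exact: est_x_integrable | exact: est_y_integrable].
- split; first exact: est_x_unbiased.
  apply: le_trans (est_y_bias w0 w tau0 Jq) _; rewrite dist2 ler_wpM2l ?lerDl ?sqr_ge0//.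
  by rewrite divr_ge0 ?sqr_ge0// ltW.
- by move=> t; exact: est_y_bounded.
(* The roles cross: the x-block is controlled by the y-displacement and the y-block by the
   x-displacement, hence the swap of the summands. *)
- rewrite dist2 mulrDr addrC EFinD; apply: leeD; last exact: est_x_second_moment.
  apply: bigmax_le => [|i _]; last exact: est_y_second_moment.
  by rewrite lee_fin mulr_ge0 ?sqr_ge0.
Qed.
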